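(* There is a nonempty open subset of the space of similarity classes of nondegenerate $4$-simplices such that every $4$-simplex whose class lies in this subset has an infinite degenerating LEB branch $(\Delta_n)_{n\ge0}$ in which every $\Delta_n$ has a unique longest edge (so the branch is independent of any tie-breaking rule).
   Context: A nondegenerate $4$-simplex is given by five affinely independent points $p_0,\dots,p_4$ of $\mathbb R^4$. Its Gram matrix is $G=X^{\mathsf T}X$ with $X=[\,p_1-p_0\,|\,p_2-p_0\,|\,p_3-p_0\,|\,p_4-p_0\,]$; labeled simplices are similar iff their Gram matrices are positive multiples of each other, so the labeled shape space is $\operatorname{Sym}_4^{>0}/\mathbb R_{>0}$ (positive definite symmetric $4\times4$ matrices modulo positive scalars), and the space of (unlabeled) similarity classes is its quotient by the action of $S_5$ permuting the vertices, with the quotient topology. Bisecting a simplex at an edge $p_ip_j$ produces two children: one in which $p_i$ is replaced by the midpoint $\tfrac12(p_i+p_j)$ and one in which $p_j$ is replaced by it, the other vertices being unchanged. An LEB (Longest Edge Bisection) branch of $\Delta$ is a sequence $(\Delta_n)_{n\ge0}$ with $\Delta_0=\Delta$ such that each $\Delta_{n+1}$ is one of the two children obtained by bisecting $\Delta_n$ at some longest edge of $\Delta_n$. It degenerates if $\vartheta_4(\Delta_n)=\operatorname{vol}_4(\Delta_n)/\operatorname{diam}(\Delta_n)^4\to0$ as $n\to\infty$. *)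

(* Defs.v *)
From HB Require Import structures.
From mathcomp Require Import all_boot all_order all_algebra all_fingroup.
From mathcomp Require Import generic_quotient.
From mathcomp Require Import all_classical all_reals all_analysis.
Import numFieldNormedType.Exports.

Set Implicit Arguments.
Unset Strict Implicit.
Unset Printing Implicit Defensive.

Import Order.TTheory GRing.Theory Num.Theory.
Local Open Scope classical_set_scope.
Local Open Scope ring_scope.
Local Open Scope quotient_scope.

Section Simplices.
Variable R : realType.

(* The norm that the library puts on matrices is the sup norm, hence the
   explicit Euclidean distance. *)
Definition edist (x y : 'cV[R]_4) : R :=
  Num.sqrt (\sum_(k < 4) (x k 0 - y k 0) ^+ 2).

Definition vertices : Type := 'I_5 -> 'cV[R]_4.

Implicit Type p : vertices.

Definition affinely_independent p : Prop :=
  forall c : 'I_5 -> R,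
    \sum_(k < 5) c k = 0 -> \sum_(k < 5) c k *: p k = 0 -> forall k, c k = 0.

Definition conv_hull p : set 'cV[R]_4 :=
  [set x | exists w : 'I_5 -> R,
    [/\ forall k, 0 <= w k, \sum_(k < 5) w k = 1 & x = \sum_(k < 5) w k *: p k]].

(* X = [p_1 - p_0 | p_2 - p_0 | p_3 - p_0 | p_4 - p_0] *)
Definition edge_matrix p : 'M[R]_4 :=
  \matrix_(i < 4, j < 4) (p (lift ord0 j) - p ord0) i 0.

Definition gram p : 'M[R]_4 := (edge_matrix p)^T *m edge_matrix p.

(* No Lebesgue measure on R^4 in the library: vol_4 is given by the standard
   formula |det X| / 4! for the volume of a simplex. *)
Definition vol4 p : R := `|\det (edge_matrix p)| / 4`!%:R.

Definition diam p : R :=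
  sup [set r | exists x y, [/\ conv_hull p x, conv_hull p y & r = edist x y]].

Definition theta4 p : R := vol4 p / diam p ^+ 4.

Definition longest_edge p (i j : 'I_5) : Prop :=
  i != j /\ forall k l : 'I_5, edist (p k) (p l) <= edist (p i) (p j).

Definition has_unique_longest_edge p : Prop :=
  exists i j, longest_edge p i j /\
    forall k l, longest_edge p k l -> [set k; l]%SET = [set i; j]%SET.

Definition midpoint (x y : 'cV[R]_4) : 'cV[R]_4 := 2^-1 *: (x + y).

Definition bisection_child p (i j : 'I_5) : vertices :=
  fun k => if k == i then midpoint (p i) (p j) else p k.

Definition is_LEB_branch p (D : nat -> vertices) : Prop :=
  D 0%N = p /\
  forall n, exists i j, longest_edge (D n) i j /\
    (D n.+1 = bisection_child (D n) i j \/ D n.+1 = bisection_child (D n) j i).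

Definition degenerates (D : nat -> vertices) : Prop :=
  theta4 (D n) @[n --> \oo] --> (0 : R).

(* Vertices 0, e_1, ..., e_4. *)
Definition std_vertices : vertices :=
  fun k => if unlift ord0 k is Some j then delta_mx j 0 else 0.

(* [edge_matrix (p \o s) = edge_matrix p *m relabel_mx s]. *)
Definition relabel_mx (s : 'S_5) : 'M[R]_4 := edge_matrix (std_vertices \o s).

Lemma edge_matrix_relabel p (s : 'S_5) :
  edge_matrix (p \o s) = edge_matrix p *m relabel_mx s.
Proof.
have E (k : 'I_5) (i : 'I_4) :
    \sum_(l < 4) edge_matrix p i l * std_vertices k l 0 = (p k - p ord0) i 0.
  rewrite /std_vertices; case: unliftP => [j ->|->].
    rewrite (bigD1 j) //= big1 => [|l lj]; rewrite !mxE ?eqxx ?mulr1 ?addr0 //.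
    by rewrite (negbTE lj) mulr0.
  by rewrite big1 => [|l _]; rewrite !mxE ?mulr0 ?subrr.
apply/matrixP => i j; rewrite mxE [RHS]mxE.
under eq_bigr => l _ do
  rewrite [relabel_mx s l j]mxE /= [X in _ * X]mxE [X in _ + X]mxE mulrBr.
by rewrite sumrB !E !mxE opprB addrA subrK.
Qed.

Lemma edge_matrix_std : edge_matrix std_vertices = 1%:M.
Proof.
apply/matrixP => i j; rewrite !mxE /std_vertices liftK unlift_none !mxE.
by rewrite subr0 eqxx andbT.
Qed.

Lemma relabel_mx1 : relabel_mx 1%g = 1%:M.
Proof.
rewrite -edge_matrix_std; congr edge_matrix.
by apply/funext => k /=; rewrite perm1.
Qed.

Lemma relabel_mxM (s t : 'S_5) :
  relabel_mx (s * t)%g = relabel_mx t *m relabel_mx s.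
Proof.
rewrite /relabel_mx -edge_matrix_relabel; congr edge_matrix.
by apply/funext => k /=; rewrite permM.
Qed.

(* Sym_4^{>0} *)
Definition sym_posdef : set 'M[R]_4 :=
  [set G | G^T = G /\
    forall v : 'cV[R]_4, v != 0 -> 0 < (v^T *m G *m v) 0 0].

Lemma gram_posdef p : affinely_independent p -> sym_posdef (gram p).
Proof.
move=> ip; split=> [|v v0]; first by rewrite /gram trmx_mul trmxK.
set w := edge_matrix p *m v.
have -> : (v^T *m gram p *m v) 0 0 = \sum_(k < 4) w k 0 ^+ 2.
  rewrite /gram mulmxA -mulmxA -trmx_mul -/w mxE.
  by apply: eq_bigr => k _; rewrite mxE expr2.
have w0 : w != 0.
  apply: contra v0 => /eqP w0.
  pose c (k : 'I_5) : R :=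
    if unlift ord0 k is Some j then v j 0 else - \sum_(j < 4) v j 0.
  have c0 : c ord0 = - \sum_(j < 4) v j 0 by rewrite /c unlift_none.
  have cS j : c (lift ord0 j) = v j 0 by rewrite /c liftK.
  have sc : \sum_(k < 5) c k = 0.
    rewrite big_ord_recl c0 addrC; apply/eqP; rewrite subr_eq0; apply/eqP.
    by apply: eq_bigr => j _; exact: cS.
  have sp : \sum_(k < 5) c k *: p k = 0.
    rewrite big_ord_recl c0 scaleNr scaler_suml addrC -sumrB.
    rewrite -[RHS]w0; apply/matrixP => i k; rewrite ord1 summxE [RHS]mxE.
    by apply: eq_bigr => j _; rewrite cS -scalerBr !mxE mulrC.
  by apply/eqP/matrixP => j k; rewrite ord1 -cS (ip c sc sp) mxE.
rewrite lt_neqAle sumr_ge0 ?andbT => [|k _]; last exact: sqr_ge0.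
apply: contra w0 => /eqP/esym/eqP; rewrite psumr_eq0 => [/allP h|k _];
  last exact: sqr_ge0.
apply/eqP/matrixP => k j; rewrite ord1 [RHS]mxE; apply/eqP.
by rewrite -sqrf_eq0; apply: h; rewrite mem_index_enum.
Qed.

Lemma relabel_posdef (s : 'S_5) (G : 'M[R]_4) :
  sym_posdef G -> sym_posdef ((relabel_mx s)^T *m G *m relabel_mx s).
Proof.
case=> Gs Gp; split=> [|v v0].
  by rewrite !trmx_mul trmxK Gs mulmxA.
rewrite !mulmxA -trmx_mul -mulmxA; apply: Gp.
apply: contra v0 => /eqP v0.
by rewrite -[v]mul1mx -relabel_mx1 -(mulgV s) relabel_mxM -mulmxA v0 mulmx0.
Qed.

Definition posdef : topologicalType := set_type sym_posdef.

(* The labeled shape space is Sym_4^{>0} / R_{>0}. *)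

Definition same_ray (G H : posdef) : bool :=
  `[< exists a : R, 0 < a /\ \val H = a *: \val G >].

Lemma same_ray_refl : reflexive same_ray.
Proof. by move=> G; apply/asboolP; exists 1; rewrite scale1r. Qed.

Lemma same_ray_sym : symmetric same_ray.
Proof.
suff h G H : same_ray G H -> same_ray H G by move=> G H; apply/idP/idP; exact: h.
move=> /asboolP[a [a0 E]]; apply/asboolP; exists a^-1; split.
  by rewrite invr_gt0.
by rewrite E scalerA mulVf ?gt_eqF// scale1r.
Qed.

Lemma same_ray_trans : transitive same_ray.
Proof.
move=> H G K /asboolP[a [a0 E]] /asboolP[b [b0 F]]; apply/asboolP.
by exists (b * a); split; [exact: mulr_gt0|rewrite F E scalerA].
Qed.

Canonical same_ray_equiv :=
  EquivRel same_ray same_ray_refl same_ray_sym same_ray_trans.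

Definition labeled_shape_space : topologicalType :=
  quotient_topology {eq_quot same_ray_equiv}.

Definition labeled_class (G : posdef) : labeled_shape_space :=
  \pi_{eq_quot same_ray_equiv} G.

(* The S_5-action on the labeled shape space that permutes the vertices; on
   Gram matrices it is [gram p |-> gram (p \o s)]. *)

Definition relabel_gram (s : 'S_5) (G : posdef) : posdef :=
  SigSub (mem_set (relabel_posdef s (set_mem (valP G)))).

Definition relabel (s : 'S_5) (x : labeled_shape_space) : labeled_shape_space :=
  labeled_class (relabel_gram s (repr x)).

Lemma relabel_class s (G : posdef) :
  relabel s (labeled_class G) = labeled_class (relabel_gram s G).
Proof.
apply/eqmodP/asboolP.
have /eqmodP/asboolP[a [a0 E]] : labeled_class (repr (labeled_class G)) =
    labeled_class G by exact: reprK.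
by exists a; split=> //=; rewrite E -scalemxAr -scalemxAl.
Qed.

Lemma relabel1 x : relabel 1%g x = x.
Proof.
rewrite -[x in RHS]reprK; congr labeled_class; apply: val_inj => /=.
by rewrite relabel_mx1 trmx1 mul1mx mulmx1.
Qed.

Lemma relabelM s t x : relabel (s * t)%g x = relabel s (relabel t x).
Proof.
rewrite [relabel t x]/relabel relabel_class; congr labeled_class; apply: val_inj => /=.
by rewrite relabel_mxM trmx_mul !mulmxA.
Qed.

Definition same_orbit (x y : labeled_shape_space) : bool :=
  `[< exists s : 'S_5, y = relabel s x >].

Lemma same_orbit_refl : reflexive same_orbit.
Proof. by move=> x; apply/asboolP; exists 1%g; rewrite relabel1. Qed.

Lemma same_orbit_sym : symmetric same_orbit.
Proof.
suff h x y : same_orbit x y -> same_orbit y x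
  by move=> x y; apply/idP/idP; exact: h.
move=> /asboolP[s ->]; apply/asboolP; exists s^-1%g.
by rewrite -relabelM mulVg relabel1.
Qed.

Lemma same_orbit_trans : transitive same_orbit.
Proof.
move=> y x z /asboolP[s ->] /asboolP[t ->]; apply/asboolP.
by exists (t * s)%g; rewrite relabelM.
Qed.

Canonical same_orbit_equiv :=
  EquivRel same_orbit same_orbit_refl same_orbit_sym same_orbit_trans.

Definition shape_space : topologicalType :=
  quotient_topology {eq_quot same_orbit_equiv}.

Definition unlabeled_class (x : labeled_shape_space) : shape_space :=
  \pi_{eq_quot same_orbit_equiv} x.

Definition similarity_class p (ip : affinely_independent p) : shape_space :=
  unlabeled_class (labeled_class (SigSub (mem_set (gram_posdef ip)))).

Lemma similarity_class_perm p (s : 'S_5) (ip : affinely_independent p)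
    (ips : affinely_independent (p \o s)) :
  similarity_class ips = similarity_class ip.
Proof.
apply/esym/eqmodP/asboolP; exists s; rewrite relabel_class.
congr labeled_class; apply: val_inj => /=.
by rewrite /gram edge_matrix_relabel trmx_mul !mulmxA.
Qed.

Lemma open_shape_space (U : set shape_space) :
  open U <-> exists2 V : set 'M[R]_4, open V &
    forall G : posdef, V (\val G) <-> U (unlabeled_class (labeled_class G)).
Proof.
split=> -[V oV VU]; exists V => //; last by apply/seteqP; split=> G /VU.
by move=> G; have /(congr1 (@^~ G)) /= <- := VU.
Qed.

End Simplices.

(* Main.v *)
(** Bisect the edge (0,1), replace vertex 0 by the midpoint and relabel the
    vertices by a permutation that depends only on the step modulo 3, so that
    the edge to be bisected is (0,1) again.  On five points modulo translation
    nine such steps act as 1/4 on a three-dimensional space of configurations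
    and as -1/8 on a line, spanned by (4,-2,1,-2,1).  Hence after 9N + t steps
    the edge vectors are 4^-N (u + (-1/2)^N v), where u and v are the planar
    and transverse parts of the edge vectors after t steps, and the edge (0,1)
    stays the unique longest one for ever as soon as finitely many strict
    linear inequalities between entries of the Gram matrix hold; these are
    satisfied by an explicit simplex.  The volume halves at each step, so it is
    of order 2^(-9N), whereas diam^4 is of order 2^(-8N). *)

Require Import Defs.
From mathcomp Require Import all_boot all_order all_algebra all_fingroup.
From mathcomp Require Import generic_quotient.
From mathcomp Require Import all_classical all_reals all_analysis.
From mathcomp Require Import zify ring lra.
Import Defs.
Import Order.TTheory GRing.Theory Num.Theory.
Import numFieldNormedType.Exports.

Set Implicit Arguments.
Unset Strict Implicit.
Unset Printing Implicit Defensive.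

Local Open Scope classical_set_scope.
Local Open Scope ring_scope.
Local Open Scope quotient_scope.

(** * Bisection steps as linear maps and the spectrum of nine steps *)

Definition rotation : 'S_5 := perm (@addrI _ (1 : 'I_5)).

(** The rotation lists the old vertices 1, 2, 3, 4 and then the midpoint that replaces 0; every
    third step also exchanges the old vertices 3 and 4. *)
Definition step_perm (n : nat) : 'S_5 :=
  if (n %% 3 == 2)%N then (rotation * tperm 3 4)%g else rotation.

Section Steps.
Variables (R : realType).
Implicit Types (V : lmodType R) (n : nat).

Definition step V n (z : 'I_5 -> V) : 'I_5 -> V :=
  (fun k => if k == 0 then 2^-1 *: (z 0 + z 1) else z k) \o step_perm n.

Fixpoint run V n (z : 'I_5 -> V) : 'I_5 -> V :=
  if n is m.+1 then step m (run m z) else z.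

(** The permutations have period 3 in the step number, so a run resumed at a multiple of 3 repeats
    the steps of a fresh run. *)
Lemma run_add V m n (z : 'I_5 -> V) :
  (3 %| m)%N -> run (n + m) z = run n (run m z).
Proof.
move=> m3; elim: n => //= n ->; rewrite /step /step_perm.
by move: m3 => /dvdnP[q ->]; rewrite addnC modnMDl.
Qed.

(** Taking midpoints is linear and fixes a translation [h] common to all vertices. *)
Lemma run_combination V n (h : V) (a b : R) (u v : 'I_5 -> V) :
  run n (fun k => h + a *: u k + b *: v k) =
  (fun k => h + a *: run n u k + b *: run n v k).
Proof.
elim: n => //= n ->; apply/funext => k; rewrite /step /=.
case: ifP => // _.
have hh : 2^-1 *: h + 2^-1 *: h = h.
  by rewrite -scalerDl -[2^-1]mul1r -splitr scale1r.
rewrite addrACA [X in X + _]addrACA !scalerDr hh !scalerA.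
by rewrite ![2^-1 * _]mulrC.
Qed.

Lemma run_linear (U V : lmodType R) n (f : {linear U -> V}) (z : 'I_5 -> U) :
  run n (f \o z) = f \o run n z.
Proof.
elim: n => //= n ->; apply/funext => k; rewrite /step /=.
by case: ifP => _ //=; rewrite linearZ_LR (linearD f).
Qed.

Definition list5 V (a b c d e : V) : 'I_5 -> V :=
  fun k => nth 0 [:: a; b; c; d; e] k.

Lemma list5E V (z : 'I_5 -> V) : z = list5 (z 0) (z 1) (z 2) (z 3) (z 4).
Proof.
apply/funext => k; case: k => [[|[|[|[|[|//]]]]] i]; rewrite /list5 /=;
  congr z; exact/val_inj.
Qed.

Lemma step_list5 V n (a b c d e : V) :
  step n (list5 a b c d e) =
  if (n %% 3 == 2)%N then list5 b c e d (2^-1 *: (a + b))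
  else list5 b c d e (2^-1 *: (a + b)).
Proof.
apply/funext => k; rewrite /step /step_perm /=.
case: (n %% 3 == 2)%N; rewrite ?permM permE;
 case: k => [[|[|[|[|[|//]]]]] i]; rewrite ?permE //.
Qed.

(* (4,-2,1,-2,1) spans the eigenspace of nine steps for -1/8 (and of three
   steps for -1/2); [transverse] is the coordinate along it that vanishes on
   the other eigenspaces. *)
Definition transverse_config V (f : V) : 'I_5 -> V :=
  fun k => list5 4 (- 2) 1 (- 2) (1 : R^o) k *: f.

Definition transverse V (z : 'I_5 -> V) : V :=
  9^-1 *: (2 *: z 0 + z 1 + z 2 - 2 *: z 3 - 2 *: z 4).

Definition planar V (z : 'I_5 -> V) : 'I_5 -> V :=
  fun k => z k - transverse_config (transverse z) k.

Lemma ord5_cases (P : 'I_5 -> Prop) :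
  P 0 -> P 1 -> P 2 -> P 3 -> P 4 -> forall k, P k.
Proof.
move=> P0 P1 P2 P3 P4 [[|[|[|[|[|//]]]]] i].
- by rewrite (_ : Ordinal i = 0)//; apply: val_inj.
- by rewrite (_ : Ordinal i = 1)//; apply: val_inj.
- by rewrite (_ : Ordinal i = 2)//; apply: val_inj.
- by rewrite (_ : Ordinal i = 3)//; apply: val_inj.
- by rewrite (_ : Ordinal i = 4)//; apply: val_inj.
Qed.

Lemma run9_planar (z : 'I_5 -> 'cV[R]_4) :
  exists h, run 9 (planar z) = fun k => h + 4^-1 *: planar z k.
Proof.
(* Vertex 0 forces this translation; at the other vertices the claim is a linear identity in the
   coordinates of [z]. *)
exists (run 9 (planar z) 0 - 4^-1 *: planar z 0); apply/funext => k.
apply/matrixP => i j; rewrite {1 2}[planar z]list5E /= !step_list5 /=.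
move: k; apply: ord5_cases;
rewrite /list5 /planar /transverse_config /transverse /list5 /= !mxE; lra.
Qed.

Lemma run9_transverse_config (f : 'cV[R]_4) :
  run 9 (transverse_config f) = fun k => (- 8^-1) *: transverse_config f k.
Proof.
rewrite {1}[transverse_config f]list5E /= !step_list5 /=.
apply/funext; apply: ord5_cases; apply/matrixP => i j;
 rewrite /transverse_config /list5 /= !mxE; lra.
Qed.

End Steps.

(** * Edge lengths along the run and uniqueness of the longest edge *)

Section Gaps.
Variables (R : realType).

Lemma run_9muln (z : vertices R) N :
  exists h, run (9 * N) z = fun k =>
    h + (4^-1) ^+ N *: planar z k
      + (- 8^-1) ^+ N *: transverse_config (transverse z) k.
Proof.
elim: N => [|N [h IH]].
  exists 0; apply/funext => k.
  by rewrite muln0 /= !expr0 !scale1r add0r /planar subrK.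
have [h' E] := run9_planar z.
exists (h + (4^-1) ^+ N *: h').
rewrite mulnS run_add ?dvdn_mulr// IH run_combination E run9_transverse_config.
by apply/funext => k; rewrite scalerDr addrA !scalerA -!exprSr.
Qed.

Definition planar_edge t (z : vertices R) k l :=
  run t (planar z) k - run t (planar z) l.

Definition transverse_edge t (z : vertices R) k l :=
  run t (transverse_config (transverse z)) k
  - run t (transverse_config (transverse z)) l.

(** The translation cancels in a difference, and since -1/8 = 1/4 * (-1/2) the factor [4^-1 ^+ N]
    comes out of both parts. *)
Lemma edge_run t N (z : vertices R) k l :
  run (t + 9 * N) z k - run (t + 9 * N) z l =
  (4^-1) ^+ N *: (planar_edge t z k l
                  + (- 2^-1) ^+ N *: transverse_edge t z k l).
Proof.
have [h E] := run_9muln z N.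
rewrite run_add ?dvdn_mulr// E run_combination.
have -> : - 8^-1 = 4^-1 * - 2^-1 :> R by lra.
rewrite exprMn -scalerA /planar_edge /transverse_edge.
by apply/matrixP => i j; rewrite !mxE; ring.
Qed.

Definition dot (u v : 'cV[R]_4) : R := (u^T *m v) 0 0.
Definition form (G : 'M[R]_4) (u v : 'cV[R]_4) : R := (u^T *m G *m v) 0 0.

Lemma form_gram (p : vertices R) u v :
  form (gram p) u v = dot (edge_matrix p *m u) (edge_matrix p *m v).
Proof. by rewrite /form /dot /gram trmx_mul !mulmxA. Qed.

Lemma dotE u v : dot u v = \sum_(i < 4) u i 0 * v i 0.
Proof. by rewrite /dot mxE; apply: eq_bigr => i _; rewrite mxE. Qed.

Lemma edist_sqr (x y : 'cV[R]_4) : edist x y ^+ 2 = dot (x - y) (x - y).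
Proof.
rewrite sqr_sqrtr ?sumr_ge0// => [|i _]; last exact: sqr_ge0.
by rewrite dotE; apply: eq_bigr => i _; rewrite !mxE expr2.
Qed.

Lemma dot_perturb (u v : 'cV[R]_4) (a s : R) :
  dot (a *: (u + s *: v)) (a *: (u + s *: v)) =
  a ^+ 2 * (dot u u + 2 * s * dot u v + s ^+ 2 * dot v v).
Proof.
rewrite !dotE !mulr_sumr -!big_split /= mulr_sumr.
by apply: eq_bigr => i _; rewrite !mxE; ring.
Qed.

(* Lower bound for |u + s v|^2 - |u' + s v'|^2 over |s| <= 1, with (u, v) the
   parts of the edge (0,1) and (u', v') those of the edge (k,l). *)
Definition gap (b : 'cV[R]_4 -> 'cV[R]_4 -> R) (z : vertices R) t k l : R :=
  let u := planar_edge t z in let v := transverse_edge t z in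
  b (u 0 1) (u 0 1) - b (u k l) (u k l)
  - 2 * `|b (u 0 1) (v 0 1) - b (u k l) (v k l)|
  - `|b (v 0 1) (v 0 1) - b (v k l) (v k l)|.

Lemma gap_le (z : vertices R) t N k l :
  16^-1 ^+ N * gap dot z t k l <=
  edist (run (t + 9 * N) z 0) (run (t + 9 * N) z 1) ^+ 2
  - edist (run (t + 9 * N) z k) (run (t + 9 * N) z l) ^+ 2.
Proof.
rewrite !edist_sqr !edge_run !dot_perturb.
have -> : (4^-1 ^+ N) ^+ 2 = 16^-1 ^+ N :> R.
  by rewrite exprAC; congr (_ ^+ _); lra.
rewrite -mulrBr ler_wpM2l ?exprn_ge0 ?invr_ge0//.
set s := _ ^+ N.
have s1 : `|s| <= 1.
  by rewrite normrX exprn_ile1// normrN ger0_norm ?invr_ge0//; lra.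
rewrite /gap; set u := planar_edge t z; set v := transverse_edge t z.
set B := dot (u 0 1) (v 0 1) - _; set C := dot (v 0 1) (v 0 1) - _.
have sB : - `|B| <= s * B.
  by rewrite lerNl (le_trans (ler_norm _))// normrN normrM ler_piMl.
have sC : - `|C| <= s ^+ 2 * C.
  rewrite lerNl (le_trans (ler_norm _))// normrN normrM ler_piMl//.
  by rewrite normrX exprn_ile1.
rewrite /B /C in sB sC *; lra.
Qed.

(** The pairs with [k < l] and [1 < l] are exactly the nine edges other than (0,1), each listed
    once. *)
Definition first_edge_longest (p : vertices R) :=
  forall k l : 'I_5, (k < l)%N -> (1 < l)%N ->
    edist (p k) (p l) < edist (p 0) (p 1).

Definition positive_gaps b (z : vertices R) :=
  forall t (k l : 'I_5), (t < 9)%N -> (k < l)%N -> (1 < l)%N -> 0 < gap b z t k l.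

Lemma positive_gaps_run (z : vertices R) n :
  positive_gaps dot z -> first_edge_longest (run n z).
Proof.
move=> zP k l kl l1.
rewrite (divn_eq n 9) addnC mulnC -(@ltr_pXn2r _ 2) ?nnegrE ?sqrtr_ge0//.
rewrite -subr_gt0; apply: lt_le_trans (gap_le _ _ _ _ _).
by rewrite mulr_gt0 ?exprn_gt0 ?invr_gt0// zP// ltn_pmod.
Qed.

Lemma edistC (x y : 'cV[R]_4) : edist x y = edist y x.
Proof.
by congr Num.sqrt; apply: eq_bigr => i _; rewrite -sqrrN opprB.
Qed.

Lemma first_edge_longest_neq (p : vertices R) (k l : 'I_5) :
  first_edge_longest p -> k != l ->
  [set k; l]%SET = [set 0; 1]%SET \/ edist (p k) (p l) < edist (p 0) (p 1).
Proof.
move=> pP; wlog kl : k l / (k < l)%N => [hw kl|_].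
  have /orP[] : (k < l)%N || (l < k)%N by rewrite -neq_ltn.
    by move/hw; exact.
  by move/hw; rewrite eq_sym finset.setUC edistC; exact.
have [l1|l1] := ltnP 1 l; [by right; exact: pP|left].
have k0 : k = 0 by apply/val_inj => /=; case: k kl => -[|k] //= _ kl; lia.
have -> : l = 1; last by rewrite k0.
apply/val_inj => /=; lia.
Qed.

Lemma edist_self (x : 'cV[R]_4) : edist x x = 0.
Proof. by rewrite /edist big1 ?sqrtr0// => i _; rewrite subrr expr0n. Qed.

Lemma first_edge_longest_relabel (p : vertices R) (s : 'S_5) :
  first_edge_longest p ->
  longest_edge (p \o s) ((s^-1)%g 0) ((s^-1)%g 1) /\
  has_unique_longest_edge (p \o s).
Proof.
move=> pP.
have L : longest_edge (p \o s) ((s^-1)%g 0) ((s^-1)%g 1).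
  split=> [|k l]; first by rewrite (inj_eq perm_inj).
  rewrite /= !permKV; have [->|kl] := eqVneq k l.
    by rewrite edist_self sqrtr_ge0.
  have /(first_edge_longest_neq pP)[E|/ltW//] : s k != s l.
    by rewrite (inj_eq perm_inj).
  have : s k \in [set 0; 1]%SET by rewrite -E !inE eqxx.
  have : s l \in [set 0; 1]%SET by rewrite -E !inE eqxx orbT.
  rewrite !inE => /orP[]/eqP-> /orP[]/eqP->; rewrite ?edist_self ?sqrtr_ge0//.
  by rewrite edistC.
split=> //; exists ((s^-1)%g 0), ((s^-1)%g 1); split => // k l [kl klP].
have /(first_edge_longest_neq pP)[E|] : s k != s l by rewrite (inj_eq perm_inj).
  apply: (@imset_inj _ _ s perm_inj).
  by rewrite !imsetU1 !imset_set1 !permKV.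
by have := klP ((s^-1)%g 0) ((s^-1)%g 1); rewrite /= !permKV leNgt => /negP.
Qed.

(** Undoes [s] and the step permutations accumulated so far, so that a vertex surviving a bisection
    keeps its label, as [bisection_child] demands. *)
Fixpoint relabeling (s : 'S_5) n : 'S_5 :=
  if n is m.+1 then (relabeling s m * (step_perm m)^-1)%g else (s^-1)%g.

Lemma LEB_branch_run (p : vertices R) (s : 'S_5) :
  (forall n, first_edge_longest (run n (p \o s))) ->
  is_LEB_branch p (fun n => run n (p \o s) \o relabeling s n).
Proof.
move=> pP; split=> [|n]; first by apply/funext => k /=; rewrite permKV.
set r := relabeling s n.
exists ((r^-1)%g 0), ((r^-1)%g 1); split.
  by have [] := first_edge_longest_relabel r (pP n).
left; apply/funext => k; rewrite /= /step /=.
rewrite permM permKV /bisection_child /= !permKV.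
by rewrite -[k == _](inj_eq (@perm_inj _ r)) permKV.
Qed.

End Gaps.

(** * Volume against diameter, and decay of [theta4] *)

Section Degeneration.
Variables (R : realType).

(** As [s] has finite order, the determinant is a root of unity. *)
Lemma norm_det_relabel (s : 'S_5) : `|\det (relabel_mx R s)| = 1.
Proof.
have detX n : \det (relabel_mx R (s ^+ n)%g) = \det (relabel_mx R s) ^+ n.
  elim: n => [|n IH]; first by rewrite expg0 relabel_mx1 det1 expr0.
  by rewrite expgS relabel_mxM det_mulmx IH exprSr.
apply/eqP; rewrite -(@pexpr_eq1 _ _ #[s]%g) ?order_gt0//.
by rewrite -normrX -detX expg_order relabel_mx1 det1 normr1.
Qed.

Lemma vol4_relabel (p : vertices R) (s : 'S_5) : vol4 (p \o s) = vol4 p.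
Proof.
by rewrite /vol4 edge_matrix_relabel det_mulmx normrM norm_det_relabel mulr1.
Qed.

Lemma vol4_step n (p : vertices R) : vol4 (step n p) = 2^-1 * vol4 p.
Proof.
rewrite /step vol4_relabel /vol4.
set q := fun k => _.
(* Moving p_0 to the midpoint subtracts half of p_1 - p_0 from every edge vector; this column
   operation is upper triangular with diagonal (1/2, 1, 1, 1). *)
pose M : 'M[R]_4 := \matrix_(i, j) ((i == j)%:R - 2^-1 * (i == 0)%:R).
have -> : edge_matrix q = edge_matrix p *m M.
  apply/matrixP => i j; rewrite !mxE.
  under eq_bigr => l _ do rewrite [M _ _]mxE mulrBr.
  rewrite sumrB (bigD1 j)//= big1 => [|l /negPf->]; last by rewrite mulr0.
  rewrite (bigD1 0)//= big1 => [|l /negPf->]; last by rewrite !mulr0.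
  rewrite !mxE !eqxx /q /=.
  have -> : lift ord0 0 = 1 :> 'I_5 by apply/val_inj.
  by case: (j == 0); lra.
have dM : \det M = 2^-1.
  rewrite -det_tr det_trig.
    by rewrite !big_ord_recl big_ord0 !mxE /=; lra.
  apply/is_trig_mxP => i j ij; rewrite !mxE.
  have -> : (j == i) = false by apply/negbTE; rewrite neq_ltn ij orbT.
  have -> : (j == 0) = false by apply/negbTE; case: j ij => -[].
  by rewrite mulr0 subr0.
by rewrite det_mulmx dM normrM (@ger0_norm _ 2^-1) ?invr_ge0//; lra.
Qed.

Lemma vol4_run n (p : vertices R) : vol4 (run n p) = 2^-1 ^+ n * vol4 p.
Proof. by elim: n => [|n IH] /=; rewrite ?mul1r// vol4_step IH exprS mulrA. Qed.

Lemma edist_le_diam (p : vertices R) k l : edist (p k) (p l) <= diam p.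
Proof.
apply: ub_le_sup; last first.
  have hull k' : conv_hull p (p k').
    exists (fun l => (l == k')%:R); split => //.
    - by rewrite (bigD1 k')//= eqxx big1 ?addr0// => i /negPf->.
    - rewrite (bigD1 k')//= eqxx scale1r big1 ?addr0// => i /negPf->.
      by rewrite scale0r.
  by exists (p k), (p l).
(* [sup] dominates its set only if the set is bounded: [M c] bounds coordinate [c] on the whole
   hull. *)
pose M c : R := \sum_(k < 5) `|p k c 0|.
exists (Num.sqrt (\sum_(c < 4) (2 * M c) ^+ 2)) => _ [x [y [xP yP ->]]].
have bd z c : conv_hull p z -> `|z c 0| <= M c.
  move=> [w [w0 w1 ->]]; rewrite summxE (le_trans (ler_norm_sum _ _ _))//.
  apply: ler_sum => i _.
  rewrite mxE normrM ler_piMl// ger0_norm// -w1 (bigD1 i)//= lerDl.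
  by rewrite sumr_ge0.
rewrite ler_sqrt ?sumr_ge0// => [|c _]; last exact: sqr_ge0.
apply: ler_sum => c _.
have M0 : 0 <= M c by rewrite sumr_ge0.
rewrite -[leLHS]real_normK ?num_real// lerXn2r ?nnegrE ?mulr_ge0//.
by rewrite (le_trans (ler_normB _ _))// mulr_natl mulr2n lerD// bd.
Qed.

(** Serves to bound the diameter from below: by [gap_le], the squared length of (0,1) exceeds that
    of (0,2) by at least [16^-1 ^+ N * c]. *)
Lemma positive_gap_bound (z : vertices R) : positive_gaps (@dot R) z ->
  exists2 c, 0 < c & forall t, (t < 9)%N -> c <= gap (@dot R) z t 0 2.
Proof.
move=> zP; have gp t : (t < 9)%N -> 0 < gap (@dot R) z t 0 2 by move=> t9; exact: zP.
exists (\big[Num.min/1]_(t < 9) gap (@dot R) z t 0 2).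
  by apply: lt_bigmin => // t _; exact: gp.
by move=> t t9; exact: (@bigmin_le_cond _ _ _ _ (Ordinal t9) xpredT
  (fun i : 'I_9 => gap (@dot R) z i 0 2)).
Qed.

(** With N = n / 9, the volume is at most 2^(-9N) [vol4 z] and diam^4 is at least 2^(-8N) c^2. The
    bound is uniform in [s] because the labeling of the branch changes with [n]. *)
Lemma theta4_run_le (z : vertices R) : positive_gaps (@dot R) z ->
  exists K, forall n (s : 'S_5), 0 <= theta4 (run n z \o s) <= K * 2^-1 ^+ (n %/ 9).
Proof.
move=> zP; have [c c0 cP] := positive_gap_bound zP.
exists (vol4 z / c ^+ 2) => n s.
rewrite /theta4 vol4_relabel vol4_run.
set q := run n z \o s; set N := (n %/ 9)%N.
have dc : 16^-1 ^+ N * c <= diam q ^+ 2.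
  have := @gap_le R z (n %% 9) N 0 2; rewrite mulnC addnC -divn_eq.
  set e := edist (run n z 0) (run n z 1).
  have e_diam : e <= diam q.
    have := edist_le_diam q ((s^-1)%g 0) ((s^-1)%g 1).
    by rewrite /q /= !permKV.
  have e2 : e ^+ 2 <= diam q ^+ 2.
    by rewrite lerXn2r ?nnegrE ?sqrtr_ge0// (le_trans _ e_diam)// sqrtr_ge0.
  move=> h; apply: le_trans e2; apply: le_trans (le_trans h _); last first.
    by rewrite gerBl sqr_ge0.
  by rewrite ler_wpM2l ?exprn_ge0 ?invr_ge0// cP// ltn_pmod.
have dc4 : 2^-1 ^+ (8 * N) * c ^+ 2 <= diam q ^+ 4.
  rewrite (exprM _ 2 2) (_ : 2^-1 ^+ (8 * N) * c ^+ 2 = (16^-1 ^+ N * c) ^+ 2).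
    by rewrite lerXn2r// nnegrE ?sqr_ge0// mulr_ge0 ?(ltW c0) ?exprn_ge0 ?invr_ge0.
  by rewrite exprMn exprAC exprM; congr (_ ^+ _ * _); field.
have v0 : 0 <= vol4 z by rewrite mulr_ge0 ?invr_ge0.
have D0 : 0 < diam q ^+ 4.
  by apply: lt_le_trans dc4; rewrite mulr_gt0 ?exprn_gt0 ?invr_gt0.
apply/andP; split.
  by rewrite divr_ge0 ?(ltW D0)// mulr_ge0// exprn_ge0 ?invr_ge0.
rewrite ler_pdivrMr// mulrAC.
apply: (@le_trans _ _
  (vol4 z / c ^+ 2 * (2^-1 ^+ (8 * N) * c ^+ 2) * 2^-1 ^+ N)); last first.
  apply: ler_wpM2r; first by rewrite exprn_ge0 ?invr_ge0.
  by rewrite ler_wpM2l// divr_ge0// sqr_ge0.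
have -> : vol4 z / c ^+ 2 * (2^-1 ^+ (8 * N) * c ^+ 2) * 2^-1 ^+ N =
    2^-1 ^+ (8 * N + N) * vol4 z.
  by rewrite exprD; field; rewrite gt_eqF.
apply: ler_wpM2r => //; apply: ler_wiXn2l; rewrite ?invr_ge0//; first lra.
rewrite /N; lia.
Qed.

Lemma degenerates_run (z : vertices R) (s : nat -> 'S_5) :
  positive_gaps (@dot R) z -> degenerates (fun n => run n z \o s n).
Proof.
move=> /theta4_run_le[K KP].
rewrite /degenerates.
apply: (@squeeze_cvgr _ _ _ _ (fun=> 0) (fun n => K * 2^-1 ^+ (n %/ 9))).
- by near=> n; exact: KP.
- exact: cvg_cst.
- rewrite -[X in _ --> X](mulr0 K); apply: cvgMl_tmp.
  apply: (@cvg_comp _ _ _ (fun n => n %/ 9)%N (fun n => 2^-1 ^+ n) _ \oo).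
    move=> A [N _ NA]; exists (9 * N)%N => // n /= nN; apply: NA => /=.
    by rewrite leq_divRL// mulnC.
  apply: cvg_expr; rewrite ger0_norm ?invr_ge0//; lra.
Unshelve. all: by end_near. Qed.

End Degeneration.

(** * The gap conditions as an open set of similarity classes *)

Section ShapeSpace.
Variables (R : realType).
Local Notation std := (std_vertices R).

Lemma run_affine n (M : 'M[R]_4) (h : 'cV[R]_4) (z : vertices R) :
  run n (fun k => h + M *m z k) = fun k => h + M *m run n z k.
Proof.
have -> : (fun k => h + M *m z k) =
    (fun k => h + 1 *: (mulmx M \o z) k + 0 *: (z k)).
  by apply/funext => k; rewrite scale1r scale0r addr0.
rewrite run_combination run_linear.
by apply/funext => k; rewrite scale1r scale0r addr0.
Qed.

Lemma transverse_affine (M : 'M[R]_4) (h : 'cV[R]_4) (z : vertices R) :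
  transverse (fun k => h + M *m z k) = M *m transverse z.
Proof.
rewrite /transverse -scalemxAr !mulmxBr !mulmxDr -!scalemxAr; congr (_ *: _).
by apply/matrixP => i j; rewrite ![(_ + _ : 'cV_4) _ _]mxE !mxE; lra.
Qed.

Lemma vertices_affine (p : vertices R) :
  p = fun k => p 0 + edge_matrix p *m std k.
Proof.
apply/funext => k; rewrite /std_vertices; case: unliftP => [j ->|->]; last first.
  by rewrite mulmx0 addr0.
apply/matrixP => i c; rewrite ord1 -colE !mxE /=; ring.
Qed.

Lemma transverse_config_mulmx (M : 'M[R]_4) (f : 'cV[R]_4) :
  transverse_config (M *m f) = mulmx M \o transverse_config f.
Proof. by apply/funext => k; rewrite /transverse_config /= scalemxAr. Qed.

Lemma planar_affine (M : 'M[R]_4) (h : 'cV[R]_4) (z : vertices R) :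
  planar (fun k => h + M *m z k) = fun k => h + M *m planar z k.
Proof.
apply/funext => k; rewrite /planar transverse_affine transverse_config_mulmx /=.
by rewrite mulmxBr addrA.
Qed.

(** Runs and the splitting into planar and transverse parts commute with affine maps, and [p] is the
    affine image of the standard vertices under [edge_matrix p]. Pulling the dot product back along
    that matrix yields the Gram form. *)
Lemma gap_gram (p : vertices R) t k l :
  gap (form (gram p)) std t k l = gap (@dot R) p t k l.
Proof.
set M := edge_matrix p.
have pl i j : planar_edge t p i j = M *m planar_edge t std i j.
  rewrite /planar_edge [in LHS](vertices_affine p) planar_affine run_affine.
  by rewrite mulmxBr opprD addrACA subrr add0r.
have tr i j : transverse_edge t p i j = M *m transverse_edge t std i j.
  rewrite /transverse_edge [in LHS](vertices_affine p) transverse_affine.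
  by rewrite transverse_config_mulmx run_linear /= mulmxBr.
by rewrite /gap !form_gram !pl !tr.
Qed.

Lemma form_continuous (u v : 'cV[R]_4) : continuous (fun G : 'M[R]_4 => form G u v).
Proof.
have -> : (fun G : 'M[R]_4 => form G u v) =
    (fun G => \sum_(j < 4) \sum_(i < 4) u i 0 * G i j * v j 0).
  apply/funext => H; rewrite /form mxE; apply: eq_bigr => j _.
  by rewrite mxE mulr_suml; apply: eq_bigr => i _; rewrite !mxE.
apply: (@continuous_big _ _ (+%R) 0 xpredT (@add_continuous R)) => j _.
apply: (@continuous_big _ _ (+%R) 0 xpredT (@add_continuous R)) => i _ G.
have c : H i j @[H --> G] --> G i j by exact: coord_continuous.
have uc : u i 0 * H i j @[H --> G] --> u i 0 * G i j by exact: cvgMl_tmp.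
have : u i 0 * H i j * v j 0 @[H --> G] --> u i 0 * G i j * v j 0.
  exact: cvgMr_tmp.
exact.
Qed.

Definition relabeled_form (s : 'S_5) (G : 'M[R]_4) u v :=
  form G (relabel_mx R s *m u) (relabel_mx R s *m v).

Lemma relabeled_form_gram (p : vertices R) s :
  relabeled_form s (gram p) = form (gram (p \o s)).
Proof.
apply/funext => u; apply/funext => v.
by rewrite /relabeled_form !form_gram edge_matrix_relabel !mulmxA.
Qed.

(** Allowing any labeling [s] makes the condition descend to unlabeled shapes. *)
Definition good_gram (G : 'M[R]_4) :=
  exists s, positive_gaps (relabeled_form s G) std.

Lemma good_gramP (p : vertices R) :
  good_gram (gram p) <-> exists s : 'S_5, positive_gaps (@dot R) (p \o s).
Proof.
by split=> -[s sP]; exists s => t k l t9 kl l1; have := sP t k l t9 kl l1;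
  rewrite relabeled_form_gram gap_gram.
Qed.

(** For a fixed [s] these are finitely many strict inequalities between continuous functions of
    [G]. *)
Lemma open_good_gram : open [set G | good_gram G].
Proof.
rewrite openE => G [s sP].
suff : \forall H \near G, forall i : 'I_9 * 'I_5 * 'I_5,
    (i.1.2 < i.2)%N -> (1 < i.2)%N ->
    0 < gap (relabeled_form s H) std i.1.1 i.1.2 i.2.
  apply: filterS => H HP; exists s => t k l t9 kl l1.
  by have := HP (Ordinal t9, k, l) kl l1.
have := @filter_forall 'M[R]_4 ('I_9 * 'I_5 * 'I_5)%type
  (fun i H => (i.1.2 < i.2)%N -> (1 < i.2)%N ->
  0 < gap (relabeled_form s H) std i.1.1 i.1.2 i.2) (nbhs G) _.
apply => -[[t k] l] /=.
have [kl|] := boolP ((k < l)%N && (1 < l)%N); last first.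
  by move=> /negP h; apply: nearW => H kl l1; case: h; rewrite kl.
case/andP: kl => kl l1.
have : 0 < gap (relabeled_form s G) std t k l by exact: sP.
suff c : {for G, continuous (fun H => gap (relabeled_form s H) std t k l)}.
  move=> g0; have gt0 := @cvgr_gt _ _ _ _ _ _ c _ g0.
  by near=> H => _ _; near: H; exact: gt0.

have fc u v : form H u v @[H --> G] --> form G u v by exact: form_continuous.
have fc2 u v u' v' : form H u v - form H u' v' @[H --> G]
    --> form G u v - form G u' v' by exact: (cvgB (fc _ _) (fc _ _)).
have nc u v u' v' : `|form H u v - form H u' v'| @[H --> G]
    --> `|form G u v - form G u' v'| by exact: (cvg_norm (fc2 _ _ _ _)).
have nc2 u v u' v' : 2 * `|form H u v - form H u' v'| @[H --> G]
    --> 2 * `|form G u v - form G u' v'| by exact: (cvgM (cvg_cst _) (nc _ _ _ _)).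
have : gap (relabeled_form s H) std t k l @[H --> G]
    --> gap (relabeled_form s G) std t k l; last by exact.
exact: (cvgB (cvgB (fc2 _ _ _ _) (nc2 _ _ _ _)) (nc _ _ _ _)).
Unshelve. all: end_near. Qed.

(** Passing from [r] to [r * s^-1] compensates the relabeling, and a gap is positively homogeneous
    of degree one in the form. *)
Lemma good_gram_ray (a : R) (s : 'S_5) (G : 'M[R]_4) : 0 < a -> good_gram G ->
  good_gram (a *: ((relabel_mx R s)^T *m G *m relabel_mx R s)).
Proof.
move=> a0 [r rP]; exists (r * s^-1)%g => t k l t9 kl l1.
have E u v : relabeled_form (r * s^-1)%g
    (a *: ((relabel_mx R s)^T *m G *m relabel_mx R s)) u v =
    a * relabeled_form r G u v.
  have Er : relabel_mx R r = relabel_mx R s *m relabel_mx R (r * s^-1)%g.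
    by rewrite -relabel_mxM mulgKV.
  rewrite /relabeled_form Er /form -scalemxAr -scalemxAl [LHS]mxE.
  by rewrite !trmx_mul !mulmxA.
have := rP t k l t9 kl l1; rewrite /gap !E -!mulrBr !normrM (gtr0_norm a0).
by rewrite mulrCA -!mulrBr pmulr_rgt0.
Qed.

Definition shape (G : posdef R) : shape_space R := unlabeled_class (labeled_class G).

Lemma shape_eq (G H : posdef R) : shape G = shape H ->
  good_gram (\val G) -> good_gram (\val H).
Proof.
(* The two nested quotients are unfolded in turn: the orbit relation gives [s], the ray relation
   gives [a]. *)
move=> /eqmodP/asboolP[s]; rewrite relabel_class => /esym/eqmodP/asboolP[a [a0 ->]].
exact: good_gram_ray.
Qed.

Definition good_shapes : set (shape_space R) :=
  [set x | exists2 G : posdef R, x = shape G & good_gram (\val G)].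

Lemma open_good_shapes : open good_shapes.
Proof.
apply/open_shape_space; exists [set G | good_gram G]; first exact: open_good_gram.
move=> G; split=> [gG|[H E gH]]; first by exists G.
exact: shape_eq (esym E) gH.
Qed.

Lemma good_shapesP (p : vertices R) (ip : affinely_independent p) :
  good_shapes (similarity_class ip) <-> good_gram (gram p).
Proof.
split=> [[G E gG]|gp]; last by eexists; [reflexivity|].
by have := shape_eq (esym E) gG.
Qed.

End ShapeSpace.

(** * An explicit simplex satisfying the gap conditions *)

Section Center.
Variables (R : realType).

Definition vec4 (a b c d : R) : 'cV[R]_4 := \col_i nth 0 [:: a; b; c; d] i.

(** Points 0 to 4 are the initial vertices; point n + 5 is the midpoint created at step n. *)
Definition orbit_point (n : nat) : 'cV[R]_4 := nth 0
  [:: vec4 (- 8) 12 12 4; vec4 0 0 0 (- 2); vec4 8 8 8 1;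
      vec4 (- 4) 12 4 (- 2); vec4 0 4 12 1; vec4 (- 4) 6 6 1;
      vec4 4 4 4 (- 2^-1); vec4 2 10 6 (- 2^-1); vec4 (- 2) 8 8 (- 2^-1);
      vec4 2 4 8 4^-1; vec4 0 5 5 4^-1; vec4 (- 1) 8 6 4^-1;
      vec4 2 7 7 (- 8^-1)] n.
Local Notation q := orbit_point.

(* The first three coordinates are a configuration of five points of R^3 that
   turns, up to translation, into a quarter of itself after nine steps; the
   fourth is a small multiple of the transverse configuration. *)
Definition center : vertices R := list5 (q 0) (q 1) (q 2) (q 3) (q 4).

Definition center_orbit : seq (vertices R) :=
  [:: center;
      list5 (q 1) (q 2) (q 3) (q 4) (q 5);
      list5 (q 2) (q 3) (q 4) (q 5) (q 6);
      list5 (q 3) (q 4) (q 6) (q 5) (q 7);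
      list5 (q 4) (q 6) (q 5) (q 7) (q 8);
      list5 (q 6) (q 5) (q 7) (q 8) (q 9);
      list5 (q 5) (q 7) (q 9) (q 8) (q 10);
      list5 (q 7) (q 9) (q 8) (q 10) (q 11);
      list5 (q 9) (q 8) (q 10) (q 11) (q 12)].

Lemma center_affinely_independent : affinely_independent center.
Proof.
move=> c; rewrite !big_ord_recl !big_ord0.
have -> : lift ord0 (ord0 : 'I_4) = 1 by apply/val_inj.
have -> : lift ord0 (lift ord0 (ord0 : 'I_3)) = 2 by apply/val_inj.
have -> : lift ord0 (lift ord0 (lift ord0 (ord0 : 'I_2))) = 3 by apply/val_inj.
have -> : lift ord0 (lift ord0 (lift ord0 (lift ord0 (ord0 : 'I_1)))) = 4.
  by apply/val_inj.
move=> s /matrixP e.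
have := (e 0 0, e 1 0, e 2 0, e 3 0); rewrite /center /list5 !mxE /=.
move=> [[[e0 e1] e2] e3].
by apply: ord5_cases; lra.
Qed.

Lemma run_center t : (t < 9)%N -> run t center = nth center center_orbit t.
Proof.
elim: t => // t IH t9; rewrite /= IH; last exact: ltnW.
have mid (u v w : 'cV[R]_4) : (forall i, u i 0 + v i 0 = 2 * w i 0) ->
    2^-1 *: (u + v) = w.
  by move=> h; apply/matrixP => i j; rewrite ord1 !mxE h mulrA mulVf ?mul1r.
case: t t9 {IH} => [|[|[|[|[|[|[|[|//]]]]]]]] _;
  rewrite [nth _ _ _]/= step_list5 [RHS]/= [LHS]/=; congr list5; apply: mid;
  case=> [[|[|[|[|//]]]] i]; rewrite !mxE /=; lra.
Qed.

Definition last_proj : 'M[R]_4 := delta_mx 3 3.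

Lemma last_proj_mul (v : 'cV[R]_4) i :
  (last_proj *m v) i 0 = if i == 3 then v 3 0 else 0.
Proof.
rewrite mxE (bigD1 3)//= big1 => [|j /negPf j3]; rewrite !mxE ?j3 ?andbF ?mul0r//.
by rewrite andbT addr0; case: (i == 3); rewrite ?mul1r ?mul0r.
Qed.

(** The first three coordinates of [center] have transverse coordinate 0, and the fourth is
    (4,-2,1,-2,1) itself. *)
Lemma transverse_config_center :
  transverse_config (transverse center) = mulmx last_proj \o center.
Proof.
apply/funext => k; apply/matrixP => i j; rewrite ord1 /= last_proj_mul.
move: k; apply: ord5_cases; case: i => [[|[|[|[|//]]]] i];
  rewrite /transverse_config /transverse /center /list5 /= !mxE /=; lra.
Qed.

Lemma transverse_edge_center t k l :
  transverse_edge t center k l = last_proj *m (run t center k - run t center l).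
Proof.
by rewrite /transverse_edge transverse_config_center run_linear /= mulmxBr.
Qed.

Lemma planar_edge_center t k l :
  planar_edge t center k l =
  (1%:M - last_proj) *m (run t center k - run t center l).
Proof.
rewrite /planar_edge.
have -> : planar center = mulmx (1%:M - last_proj) \o center.
  apply/funext => i; rewrite /planar transverse_config_center /=.
  by rewrite mulmxBl mul1mx.
by rewrite run_linear /= mulmxBr.
Qed.

Lemma dot_proj (v : 'cV[R]_4) :
  [/\ dot ((1%:M - last_proj) *m v) (last_proj *m v) = 0,
      dot (last_proj *m v) (last_proj *m v) = v 3 0 ^+ 2 &
      dot ((1%:M - last_proj) *m v) ((1%:M - last_proj) *m v) =
      v 0 0 ^+ 2 + v 1 0 ^+ 2 + v 2 0 ^+ 2].
Proof.
have P i : ((1%:M - last_proj) *m v) i 0 = if i == 3 then 0 else v i 0.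
  rewrite mulmxBl mul1mx; move: (last_proj_mul v i).
  move: (last_proj *m v) => u ui; rewrite !mxE ui.
  by case: eqP => [->|_]; rewrite ?subrr ?subr0.
rewrite !dotE !big_ord_recl !big_ord0 !P !last_proj_mul /=.
have -> : lift ord0 (ord0 : 'I_3) = 1 by apply/val_inj.
have -> : lift ord0 (lift ord0 (ord0 : 'I_2)) = 2 by apply/val_inj.
by split; ring.
Qed.

Lemma center_positive_gaps : positive_gaps (@dot R) center.
Proof.
move=> t k l t9 kl l1; rewrite /gap !planar_edge_center !transverse_edge_center.
have [-> -> ->] := dot_proj (run t center 0 - run t center 1).
have [-> -> ->] := dot_proj (run t center k - run t center l).
(* The planar and transverse parts lie in orthogonal coordinate subspaces, so the mixed term
   vanishes; nine edges at nine times remain to be compared numerically. *)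
rewrite subrr normr0 mulr0 subr0 subr_gt0 ltr_norml run_center//.
case: t t9 => [|[|[|[|[|[|[|[|[|//]]]]]]]]] _ /=;
  move: k l kl l1; apply: ord5_cases; apply: ord5_cases => //= _ _;
  rewrite /center /list5 /= !mxE /=; apply/andP; split; lra.
Qed.

End Center.

(** * An open set of shapes with degenerating branches *)

Theorem theorem1p3 (R : realType) :
  exists U : set (shape_space R),
    [/\ open U, U !=set0 &
      forall (p : vertices R) (ip : affinely_independent p),
        U (similarity_class ip) ->
        exists D : nat -> vertices R,
          [/\ is_LEB_branch p D,
              degenerates D &
              forall n, has_unique_longest_edge (D n)]].
Proof.
exists (@good_shapes R); split; first exact: open_good_shapes.
  exists (similarity_class (@center_affinely_independent R)).
  apply/good_shapesP/good_gramP; exists 1%g.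
  have -> : center R \o (1%g : 'S_5) = center R.
    by apply/funext => k /=; rewrite perm1.
  exact: center_positive_gaps.
move=> p ip /good_shapesP/good_gramP[s sP].
have first_longest n := positive_gaps_run n sP.
(* The run starts from the good labeling [p \o s]; [relabeling] makes the branch start at [p]
   itself. *)
exists (fun n => run n (p \o s) \o relabeling s n); split.
- exact: LEB_branch_run.
- exact: degenerates_run.
- move=> n.
  by have [] := first_edge_longest_relabel (relabeling s n) (first_longest n).
Qed.
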